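(* There exist infinitely many (pairwise non-isomorphic, simple, unweighted) graphs $X$ each of which contains two vertices $u\neq v$ that are not cospectral and such that proper fractional revival occurs on $\{u,v\}$ in $X$.
   Context: For a finite simple graph $X$ with adjacency matrix $A$, the transition matrix of the continuous quantum walk is $U(t)=\exp(itA)$, $t\in\mathbb{R}$. For a vertex $x$ let $e_x$ be the standard basis vector and $D_x=e_xe_x^T$. Fractional revival occurs on $\{u,v\}$ at time $t>0$ if $U(t)(D_u+D_v)U(-t)=D_u+D_v$, equivalently $U(t)_{u,c}=U(t)_{v,c}=0$ for every vertex $c\notin\{u,v\}$. It is proper if in addition $U(t)_{u,v}\neq 0$. Proper fractional revival occurs on $\{u,v\}$ if it occurs at some time $t>0$. Vertices $u,v$ are cospectral if the vertex-deleted subgraphs $X\setminus u$ and $X\setminus v$ have the same characteristic polynomial (equivalently $(E_r)_{u,u}=(E_r)_{v,v}$ for all spectral idempotents $E_r$ of $A$). *)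

(* Defs.v *)
From HB Require Import structures.
From mathcomp Require Import all_boot all_order all_algebra.
From mathcomp Require Import all_classical all_reals all_analysis.
From mathcomp Require Import complex.

Set Implicit Arguments.
Unset Strict Implicit.
Unset Printing Implicit Defensive.

Import Order.TTheory GRing.Theory Num.Theory numFieldNormedType.Exports.

Local Open Scope ring_scope.
Local Open Scope classical_set_scope.

Record sgraph := SGraph {
  gorder : nat;
  gadj : rel 'I_gorder;
  gadj_sym : symmetric gadj;
  gadj_irrefl : irreflexive gadj }.

Definition isomorphic (X Y : sgraph) : Prop :=
  exists2 f : 'I_(gorder X) -> 'I_(gorder Y),
    bijective f & forall x y, gadj (f x) (f y) = gadj x y.

Definition adjmx (K : pzRingType) (X : sgraph) : 'M[K]_(gorder X) :=
  \matrix_(x, y) (gadj x y)%:R.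

Section VertexDeletion.
Variables (X : sgraph) (u : 'I_(gorder X)).

(* [lift u] enumerates the vertices other than [u] in increasing order. *)
Definition del_adj : rel 'I_(gorder X).-1 :=
  fun x y => gadj (lift u x) (lift u y).

Lemma del_adj_sym : symmetric del_adj.
Proof. by move=> x y; apply: gadj_sym. Qed.

Lemma del_adj_irrefl : irreflexive del_adj.
Proof. by move=> x; apply: gadj_irrefl. Qed.

Definition del_vertex : sgraph := SGraph del_adj_sym del_adj_irrefl.

End VertexDeletion.

Definition cospectral (X : sgraph) (u v : 'I_(gorder X)) : Prop :=
  char_poly (adjmx int (del_vertex u)) = char_poly (adjmx int (del_vertex v)).

(* [limn] is total; the series converges for every matrix over [R[i]]. *)
Definition expmx (K : numFieldType) (n : nat) (M : 'M[K]_n) : 'M[K]_n :=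
  limn (series (fun k : nat => (k`!%:R)^-1 *: M ^+ k)).

Section QuantumWalk.
Variables (R : realType) (X : sgraph).
Implicit Types (t : R) (u v : 'I_(gorder X)).

Definition transition t : 'M[R[i]]_(gorder X) :=
  expmx (('i * t%:C%C) *: adjmx R[i] X).

Definition fractional_revival u v t : Prop :=
  let D := delta_mx u u + delta_mx v v in
  transition t *m D *m transition (- t) = D.

Definition proper_fractional_revival u v : Prop :=
  exists t, [/\ 0 < t, fractional_revival u v t & transition t u v != 0].

End QuantumWalk.

Arguments proper_fractional_revival R {X} u v.

(* Main.v *)
(* Join two hubs u and v to independent leaves so that A^2 restricted to {u, v}
   is M = [[17k, 6k], [6k, 8k]].  Its eigenvalues are 20k and 5k, so A has
   spectrum {0, +-r, +-2r} with r^2 = 5k, and at t = pi / r the matrix U(t) is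
   1 on the eigenspaces of 0 and +-2r and -1 on those of +-r.  Hence U(t) is a
   polynomial in A^2, which preserves the span of e_u and e_v and acts there as
   (2 / (3 r^2)) M - 5 / 3, with off-diagonal entry 4 / 5.  Deleting u or v
   leaves, up to isolated vertices, a star with 8k or 17k leaves, whose nonzero
   eigenvalues differ. *)
Require Import Defs.
From mathcomp Require Import all_boot all_order all_algebra.
From mathcomp Require Import all_classical all_reals all_analysis.
From mathcomp Require Import complex ring zify.

Set Implicit Arguments.
Unset Strict Implicit.
Unset Printing Implicit Defensive.

Import Order.TTheory GRing.Theory Num.Theory numFieldNormedType.Exports.

Local Open Scope ring_scope.
Local Open Scope classical_set_scope.

(** * Matrix series with real scalar coefficients *)

(** A positive tolerance in [R[i]] is real, and the modulus of a real difference is its absolute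
    value. *)
Lemma cvg_real_complex (R : realType) (u : nat -> R) (l : R) :
  u n @[n --> \oo] --> l ->
  ((u n)%:C%C : (R[i] : numFieldType)) @[n --> \oo] -->
    (l%:C%C : (R[i] : numFieldType)).
Proof.
move=> /cvgrPdist_lt ul; apply/cvgrPdist_lt => e e0.
have e_re : e = (complex.Re e)%:C%C.
  by case: e e0 => a b; rewrite ltcE /= => /andP[/eqP ->].
have re0 : 0 < complex.Re e by move: e0; rewrite e_re ltcR.
near=> n; rewrite -rmorphB /= normc_def /= expr0n addr0 sqrtr_sqr e_re ltcR.
by near: n; exact: ul.
Unshelve. all: by end_near. Qed.

Lemma cvg_series_scalel (R : realType) (n : nat) (c : nat -> R) (l : R)
    (F : 'M[R[i] : numFieldType]_n) :
  series c k @[k --> \oo] --> l ->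
  series (fun k => (c k)%:C%C *: F) k @[k --> \oo] -->
    (l%:C%C *: F : 'M[R[i] : numFieldType]_n).
Proof.
move=> cl.
rewrite (_ : series _ = fun k => (series c k)%:C%C *: F).
  exact: cvgZr_tmp (cvg_real_complex cl).
by apply/funext => k; rewrite /series /= rmorph_sum scaler_suml.
Qed.

Lemma scale_mulmxl (K : comPzRingType) (n : nat) (a : K) (B C : 'M[K]_n) :
  (a *: B) * C = a *: (B * C).
Proof. exact/esym/scalemxAl. Qed.

Lemma scale_mulmxr (K : comPzRingType) (n : nat) (a : K) (B C : 'M[K]_n) :
  B * (a *: C) = a *: (B * C).
Proof. exact/esym/scalemxAr. Qed.

Lemma exprmxZ (K : comPzRingType) (n : nat) (a : K) (B : 'M[K]_n) (k : nat) :
  (a *: B) ^+ k = a ^+ k *: B ^+ k.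
Proof.
elim: k => [|k IHk]; first by rewrite !expr0 scale1r.
by rewrite !exprS IHk scale_mulmxl scale_mulmxr scalerA.
Qed.

(** * The exponential of a matrix with spectrum in {0, +-r, +-2r} *)

Section ExponentialOfFiveEigenvalues.
Variables (R : realType) (n : nat) (A : 'M[R[i]]_n) (r : R).
Hypothesis r_neq0 : r != 0.
Let z : R[i] := r%:C%C.
Hypothesis A_quintic :
  A ^+ 5 = (5 * z ^+ 2) *: A ^+ 3 - (4 * z ^+ 4) *: A.

Let z_neq0 : z != 0.
Proof. by rewrite fmorph_eq0. Qed.

(** The quintic reads A (A^2 - z^2) (A^2 - 4 z^2) = 0, so in A s^j with s = A^2 the factor s^j may
    be replaced by its Lagrange interpolant at s = z^2 and s = 4 z^2. *)
Lemma quintic_odd_power (j : nat) :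
  A ^+ j.*2.+1 =
    ((4 * z ^+ j.*2 - (2 * z) ^+ j.*2) / 3) *: A +
    (((2 * z) ^+ j.*2 - z ^+ j.*2) / (3 * z ^+ 2)) *: A ^+ 3.
Proof.
elim: j => [|j IHj].
  by rewrite !expr0 subrr mul0r scale0r addr0 mulr1 (_ : _ / _ = 1)
    ?scale1r //; field.
rewrite doubleS -addn2 exprD IHj mulrDl !scale_mulmxl -exprD -exprS A_quintic.
rewrite !exprS !exprMn; set p := z ^+ _; set q := 2 ^+ _.
apply/matrixP => x y; rewrite !mxE; field.
exact: z_neq0.
Qed.

(** [C1] and [C2] are the spectral projections for +-z and +-2z. [S1] and [S2] act as +-i on the
    eigenspaces of +-z and +-2z respectively, and as 0 on the others. *)
Let C1 := (3 * z ^+ 4)^-1 *: ((4 * z ^+ 2) *: A ^+ 2 - A ^+ 4).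
Let C2 := (12 * z ^+ 4)^-1 *: (A ^+ 4 - z ^+ 2 *: A ^+ 2).
Let S1 := ('i / (3 * z ^+ 3)) *: ((4 * z ^+ 2) *: A - A ^+ 3).
Let S2 := ('i / (6 * z ^+ 3)) *: (A ^+ 3 - z ^+ 2 *: A).

(** Matching exp(itA) with cosines and sines term by term reduces its convergence to that of the
    real series. Even powers feed the cosines, odd powers the sines. *)
Lemma quintic_exp_coeff (t : R) (k : nat) :
  (k`!%:R)^-1 *: (('i * t%:C%C) *: A) ^+ k =
    ((k == 0%N)%:R%:C%C *: (1 - C1 - C2) + (cos_coeff (t * r) k)%:C%C *: C1
    + (cos_coeff (2 * (t * r)) k)%:C%C *: C2)
    + ((sin_coeff (t * r) k)%:C%C *: S1
    + (sin_coeff (2 * (t * r)) k)%:C%C *: S2).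
Proof.
have expr_double (x : R[i]) m : x ^+ m.*2 = x ^+ m * x ^+ m.
  by rewrite -addnn exprD.
have i_double m : 'i ^+ m * 'i ^+ m = (-1) ^+ m :> R[i].
  by rewrite -exprMn -expr2 sqrCi.
have cosC x m : (cos_coeff x m.*2)%:C%C =
    (-1) ^+ m * x%:C%C ^+ m.*2 / m.*2`!%:R :> R[i].
  rewrite -cos_coeff'E /cos_coeff' -exprnP fmorph_div rmorphM !rmorphXn.
  by rewrite rmorphN1 rmorph_nat.
have sinC x m : (sin_coeff x m.*2.+1)%:C%C =
    (-1) ^+ m * x%:C%C ^+ m.*2.+1 / m.*2.+1`!%:R :> R[i].
  rewrite -sin_coeff'E /sin_coeff' -exprnP fmorph_div rmorphM !rmorphXn.
  by rewrite rmorphN1 rmorph_nat.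
have trC : (t * r)%:C%C = t%:C%C * z by rewrite rmorphM.
have tr2C : (2 * (t * r))%:C%C = 2 * (t%:C%C * z).
  by rewrite !rmorphM rmorph_nat.
rewrite exprmxZ -(odd_double_half k); case: (odd k); move: k./2 => j.
  rewrite add1n !cos_coeff_odd !sinC trC tr2C /=.
  rewrite !rmorph0 !scale0r !add0r quintic_odd_power.
  have := fact_gt0 j.*2.+1; rewrite lt0n -(pnatr_eq0 R[i]).
  move: (_`!%:R) => f f_neq0.
  (* Writing (-1)^j as the square of i^j leaves the same atoms on both sides, so the identity
     becomes one of rational functions. *)
  rewrite !(exprS _ j.*2) !expr_double !exprMn -i_double.
  move: ('i ^+ j) (t%:C%C ^+ j) (z ^+ j) (2 ^+ j) => e T Z q.
  by apply/matrixP => x y; rewrite !mxE; field; rewrite f_neq0 z_neq0.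
rewrite add0n !sin_coeff_even !cosC trC tr2C.
rewrite !rmorph0 !scale0r !addr0.
(* Even powers are computed as A times an odd power, which requires k >= 2; at k = 0 the indicator
   term completes [C1 + C2] to 1. *)
case: j => [|j].
  rewrite double0 !expr0 fact0 !mulr1n !mul1r !invr1 !rmorph1 !scale1r.
  by rewrite addrAC !subrK.
rewrite [_ == 0%N]/= !rmorph0 !scale0r add0r doubleS.
rewrite (exprS A) quintic_odd_power mulrDr !scale_mulmxr -expr2 -exprS.
have := fact_gt0 j.*2.+2; rewrite lt0n -(pnatr_eq0 R[i]).
move: (_`!%:R) => f f_neq0.
rewrite !(exprS _ j.*2.+1) !(exprS _ j.*2) !expr_double (exprS _ j) !exprMn.
rewrite -i_double.
have : 'i * 'i = -1 :> R[i] by rewrite -expr2 sqrCi.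
move: ('i ^+ j) (t%:C%C ^+ j) (z ^+ j) (2 ^+ j) => e T Z q i2.
rewrite !mulrA !(mulrAC 'i _ 'i) i2.
apply/matrixP => x y; rewrite !mxE.
by field; rewrite f_neq0 z_neq0.
Qed.

(** The double angle has cosine 1 and sine 0, so only the sign on the eigenspaces of +-z flips: the
    value is [1 - 2 C1]. *)
Lemma expmx_quintic (t : R) :
  cos (t * r) = -1 -> sin (t * r) = 0 ->
  expmx (('i * t%:C%C) *: A) =
    1 - (2 / (3 * z ^+ 4)) *: ((4 * z ^+ 2) *: A ^+ 2 - A ^+ 4).
Proof.
move=> cos_tr sin_tr.
have cos_2tr : cos (2 * (t * r)) = 1.
  by rewrite mulr_natl cos_mulr2n cos_tr sqrrN expr1n mulr2n addrK.
have sin_2tr : sin (2 * (t * r)) = 0.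
  by rewrite mulr_natl sin_mulr2n sin_tr mulr0 mul0rn.
have cos_cvg (x : R) : series (cos_coeff x) k @[k --> \oo] --> cos x.
  by rewrite unlock; exact: is_cvg_series_cos_coeff.
have sin_cvg (x : R) : series (sin_coeff x) k @[k --> \oo] --> sin x.
  by rewrite unlock; exact: is_cvg_series_sin_coeff.
have delta_cvg : series (fun k : nat => (k == 0%N)%:R : R) k @[k --> \oo] -->
    (1 : R).
  (* Every partial sum except the empty one equals 1. *)
  apply: cvg_near_cst; near=> k.
  have /prednK <- : (0 < k)%N by near: k; exact: nbhs_infty_gt.
  by rewrite /series /= big_mkord big_ord_recl big1 ?addr0.
apply: cvg_lim => //.
rewrite [X in _ --> X](_ : _ = 1%:C%C *: (1 - C1 - C2) +
    (cos (t * r))%:C%C *: C1 + (cos (2 * (t * r)))%:C%C *: C2 +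
    ((sin (t * r))%:C%C *: S1 + (sin (2 * (t * r)))%:C%C *: S2)); last first.
  rewrite cos_tr cos_2tr sin_tr sin_2tr rmorphN1 !rmorph1 !rmorph0.
  rewrite !scale0r !addr0 !scale1r /C1 /C2.
  by apply/matrixP => x y; rewrite !mxE; field; exact: z_neq0.
rewrite (_ : series _ = fun m =>
    series (fun k => (k == 0%N)%:R%:C%C *: (1 - C1 - C2)) m +
    series (fun k => (cos_coeff (t * r) k)%:C%C *: C1) m +
    series (fun k => (cos_coeff (2 * (t * r)) k)%:C%C *: C2) m +
    (series (fun k => (sin_coeff (t * r) k)%:C%C *: S1) m +
     series (fun k => (sin_coeff (2 * (t * r)) k)%:C%C *: S2) m)).
  apply: cvgD; last by apply: cvgD; apply: cvg_series_scalel; exact: sin_cvg.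
  apply: cvgD; last by apply: cvg_series_scalel; exact: cos_cvg.
  by apply: cvgD; apply: cvg_series_scalel => //; exact: cos_cvg.
apply/funext => m; rewrite /series /= -!big_split /=.
by apply: eq_bigr => k _; rewrite quintic_exp_coeff.
Unshelve. all: by end_near. Qed.

End ExponentialOfFiveEigenvalues.

(** * Reduction of a bipartite matrix to its square on one colour class *)

Section BipartiteBlock.
Variables (K : numFieldType) (n : nat) (A D N : 'M[K]_n) (z : K).
Hypothesis D_idem : D * D = D.
Hypothesis A_bipartite : A * D + D * A = A.
Hypothesis A2D : A ^+ 2 * D = N.
Hypothesis N_quadratic : N * N = (5 * z ^+ 2) *: N - (4 * z ^+ 4) *: D.

(** [D] projects onto a colour class, inside which there are no edges. It follows that A^2 commutes
    with [D]. *)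
Let DAD : D * A * D = 0.
Proof.
apply: (addIr (D * A)); rewrite add0r -{3}A_bipartite mulrDr.
by rewrite !mulrA D_idem.
Qed.

Let DN : D * N = N.
Proof.
rewrite -A2D expr2 -mulrA -{3}A_bipartite mulrDl -!mulrA.
by rewrite (mulrA D A D) DAD mulr0 add0r.
Qed.

Let DA2 : D * A ^+ 2 = N.
Proof.
rewrite -[RHS]DN -A2D expr2 !mulrA -{2}A_bipartite mulrDr !mulrA.
by rewrite DAD mul0r addr0.
Qed.

Let ND : N * D = N.
Proof. by rewrite -A2D -mulrA D_idem. Qed.

Let A4D : A ^+ 4 * D = N * N.
Proof. by rewrite (exprD A 2 2) -mulrA A2D -{1}DN mulrA A2D. Qed.

Let DA4 : D * A ^+ 4 = N * N.
Proof. by rewrite (exprD A 2 2) mulrA DA2 -{1}ND -mulrA DA2. Qed.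

(** By bipartiteness A^(m+1) = A (A^m D) + (A^m D) A. For m = 2 and 4 the bracket is N or N^2, so
    the quadratic relation with roots z^2 and 4 z^2 lifts to A. *)
Lemma bipartite_block_quintic :
  A ^+ 5 = (5 * z ^+ 2) *: A ^+ 3 - (4 * z ^+ 4) *: A.
Proof.
have split_odd m : A ^+ m.+1 = A * (A ^+ m * D) + A ^+ m * D * A.
  by rewrite mulrA -exprS exprSr -!mulrA -mulrDr A_bipartite.
rewrite (split_odd 4) (split_odd 2) A4D A2D N_quadratic -{5}A_bipartite.
rewrite mulrBr mulrBl !scale_mulmxr !scale_mulmxl.
by apply/matrixP => x y; rewrite !mxE; ring.
Qed.

Let c := 2 / (3 * z ^+ 4).
Let U := 1 - c *: ((4 * z ^+ 2) *: A ^+ 2 - A ^+ 4).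

(** The affine function 2s / (3 z^2) - 5/3 takes the values -1 at s = z^2 and 1 at s = 4 z^2, as [U]
    does on these eigenspaces of A^2. *)
Lemma bipartite_block_mulr :
  z != 0 -> U * D = (2 / (3 * z ^+ 2)) *: N - (5 / 3) *: D.
Proof.
move=> z_neq0.
rewrite mulrBl mul1r scale_mulmxl mulrBl scale_mulmxl A2D A4D N_quadratic /c.
by apply/matrixP => x y; rewrite !mxE; field.
Qed.

Lemma bipartite_block_mull :
  z != 0 -> D * U = (2 / (3 * z ^+ 2)) *: N - (5 / 3) *: D.
Proof.
move=> z_neq0.
rewrite mulrBr mulr1 scale_mulmxr mulrBr scale_mulmxr DA2 DA4 N_quadratic /c.
by apply/matrixP => x y; rewrite !mxE; field.
Qed.

(** U D U = (U D) (D U) is the square of an operator with eigenvalues +-1 on the range of [D]. *)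
Lemma bipartite_block_conj : z != 0 -> U * D * U = D.
Proof.
move=> z_neq0; rewrite -[X in _ * X * _]D_idem mulrA -mulrA.
rewrite bipartite_block_mulr // bipartite_block_mull //.
rewrite mulrBr !mulrBl !scale_mulmxr !scale_mulmxl DN ND D_idem N_quadratic.
by apply/matrixP => x y; rewrite !mxE; field.
Qed.

End BipartiteBlock.

(** * The graphs and their adjacency matrices *)

(* Vertices 0 and 1 are the hubs u and v: 11k of the leaves hang on u alone,
   6k on both and 2k on v alone. *)
Definition spoke (k x y : nat) : bool :=
  ((x == 0) && (2 <= y < 2 + 17 * k) || (x == 1) && (2 + 11 * k <= y))%N.

Definition twin_star_adj (k : nat) : rel 'I_(2 + 19 * k) :=
  fun x y => spoke k x y || spoke k y x.

Lemma twin_star_sym (k : nat) : symmetric (@twin_star_adj k).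
Proof. by move=> x y; rewrite /twin_star_adj orbC. Qed.

Lemma twin_star_irrefl (k : nat) : irreflexive (@twin_star_adj k).
Proof. by move=> x; rewrite /twin_star_adj /spoke; lia. Qed.

Definition twin_star (k : nat) : sgraph :=
  SGraph (@twin_star_sym k) (@twin_star_irrefl k).

Lemma isomorphic_gorder (X Y : sgraph) : isomorphic X Y -> gorder X = gorder Y.
Proof. by case=> f /bij_eq_card; rewrite !card_ord. Qed.

Lemma sum_interval (K : pzRingType) (m a b : nat) :
  (b <= m)%N ->
  \sum_(w < m) ((a <= w < b)%N%:R : K) = (b - a)%:R.
Proof.
move=> b_le_m; rewrite -natr_sum; congr (_%:R).
(* The induction on m passes through values below b, hence the minimum. *)
suff -> : (\sum_(w < m) (a <= w < b) = minn m b - a)%N.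
  by rewrite (minn_idPr b_le_m).
elim: m {b_le_m} => [|m IHm]; first by rewrite big_ord0; lia.
by rewrite big_ord_recr /= IHm; lia.
Qed.

Section TwinStarMatrices.
Variables (K : comPzRingType) (k : nat).

(** The hub-by-leaf block: column y stands for vertex 2 + y, which accounts for the shift from
    [spoke]. *)
Definition spoke_mx : 'M[K]_(2, 19 * k) :=
  \matrix_(x, y) (if val x == 0 then y < 17 * k else 11 * k <= y)%N%:R.

Definition gram_mx : 'M[K]_2 :=
  \matrix_(x, y) (if val x == 0 then if val y == 0 then 17 * k else 6 * k
                  else if val y == 0 then 6 * k else 8 * k)%N%:R.

Lemma adjmx_twin_star :
  adjmx K (twin_star k) = block_mx 0 spoke_mx spoke_mx^T 0.
Proof.
apply/matrixP => x y; rewrite mxE /= /twin_star_adj.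
case: (split_ordP x) => i ->; case: (split_ordP y) => j ->;
  rewrite ?block_mxEul ?block_mxEur ?block_mxEdl ?block_mxEdr !mxE /= /spoke.
- by case: i j => i ? [j ?] /=; rewrite (_ : _ || _ = false) //; lia.
- by case: i j => [[|[|//]] ?] [j ?] /=; congr (nat_of_bool _)%:R; lia.
- by case: j i => [[|[|//]] ?] [i ?] /=; congr (nat_of_bool _)%:R; lia.
- by [].
Qed.

Lemma spoke_mx_gram : spoke_mx *m spoke_mx^T = gram_mx.
Proof.
apply/matrixP => x y; rewrite !mxE.
under eq_bigr => w _ do rewrite !mxE -natrM mulnb.
(* Common neighbours of two hubs form an interval of leaves, one for each entry. *)
by case: x => [[|[|//]] ?]; case: y => [[|[|//]] ?] /=;
  [rewrite (eq_bigr (fun w : 'I__ => (0 <= w < 17 * k)%N%:R))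
  |rewrite (eq_bigr (fun w : 'I__ => (11 * k <= w < 17 * k)%N%:R))
  |rewrite (eq_bigr (fun w : 'I__ => (11 * k <= w < 17 * k)%N%:R))
  |rewrite (eq_bigr (fun w : 'I__ => (11 * k <= w < 19 * k)%N%:R))];
  rewrite ?sum_interval; try lia; try (by congr (_%:R); lia);
  move=> [w ?] _; congr (nat_of_bool _)%:R => /=; lia.
Qed.

(** Cayley-Hamilton with trace 25k and determinant 17k * 8k - (6k)^2 = 100k^2. The roots 5k and 20k
    have ratio 4, as the quintic requires. *)
Lemma gram_mx_quadratic :
  gram_mx *m gram_mx = (25 * k)%:R *: gram_mx - (100 * k ^ 2)%:R *: 1%:M.
Proof.
apply/matrixP => x y; rewrite !mxE !big_ord_recl big_ord0 !mxE /=.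
by case: x => [[|[|//]] ?]; case: y => [[|[|//]] ?] /=;
  rewrite ?(mulr1, mulr0) !natrM ?natrX; ring.
Qed.

End TwinStarMatrices.

(** * Star spectra and non-cospectrality of the hubs *)

Section StarEigenvalues.
Variables (F : fieldType) (m : nat) (b : 'rV[F]_m) (d : F).
Hypothesis b_norm : b *m b^T = d%:M.
Let S : 'M[F]_(1 + m) := block_mx 0 b b^T 0.

(** A star matrix satisfies S^3 = d S. *)
Lemma star_eigenvalue_cube (a : F) : eigenvalue S a -> a ^+ 3 = d * a.
Proof.
have S3 : S *m S *m S = d *: S.
  rewrite /S !mulmx_block !(mul0mx, mulmx0, addr0, add0r) b_norm -mulmxA b_norm.
  by rewrite mul_scalar_mx mul_mx_scalar scale_block_mx !scaler0.
case/eigenvalueP => v v_eigen v_neq0; apply/eqP; rewrite -subr_eq0.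
move/eqP: (congr1 (mulmx v) S3); rewrite -scalemxAr !mulmxA v_eigen.
rewrite -!scalemxAl v_eigen -scalemxAl v_eigen !scalerA -subr_eq0 -scalerBl.
by rewrite scaler_eq0 (negPf v_neq0) orbF -expr2 -exprSr.
Qed.

Lemma star_eigenvalue_sqrt (a : F) : a != 0 -> a ^+ 2 = d -> eigenvalue S a.
Proof.
(* Multiplying the row (a | b) by [S] gives (d | a b), which is a times (a | b). *)
move=> a_neq0 a2; apply/eigenvalueP; exists (row_mx a%:M b).
  rewrite mul_row_block !mulmx0 add0r addr0 b_norm mul_scalar_mx scale_row_mx.
  by rewrite scale_scalar_mx -expr2 a2.
apply: contraNneq a_neq0 => /rowP /(_ (lshift m ord0)).
by rewrite row_mxEl !mxE eqxx mulr1n => ->.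
Qed.

End StarEigenvalues.

Definition hub0 (k : nat) : 'I_(gorder (twin_star k)) := lshift (19 * k) ord0.
Definition hub1 (k : nat) : 'I_(gorder (twin_star k)) :=
  lshift (19 * k) ord_max.

(** The surviving hub gets index 0; leaves attached only to the deleted hub remain as zero entries
    of the row. *)
Lemma adjmx_del_hub0 (K : comPzRingType) (k : nat) :
  adjmx K (del_vertex (hub0 k)) =
    block_mx 0 (row ord_max (spoke_mx K k)) (row ord_max (spoke_mx K k))^T 0
    :> 'M[K]_(1 + 19 * k).
Proof.
apply/matrixP => x y; rewrite mxE /= /del_adj /= /twin_star_adj.
case: (split_ordP x) => i ->; case: (split_ordP y) => j ->;
  rewrite ?block_mxEul ?block_mxEur ?block_mxEdl ?block_mxEdr !mxE /= /spoke
    ?ord1 /bump //=; congr (nat_of_bool _)%:R; lia.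
Qed.

Lemma adjmx_del_hub1 (K : comPzRingType) (k : nat) :
  adjmx K (del_vertex (hub1 k)) =
    block_mx 0 (row ord0 (spoke_mx K k)) (row ord0 (spoke_mx K k))^T 0
    :> 'M[K]_(1 + 19 * k).
Proof.
apply/matrixP => x y; rewrite mxE /= /del_adj /= /twin_star_adj.
case: (split_ordP x) => i ->; case: (split_ordP y) => j ->;
  rewrite ?block_mxEul ?block_mxEur ?block_mxEdl ?block_mxEdr !mxE /= /spoke
    ?ord1 /bump //=; congr (nat_of_bool _)%:R; lia.
Qed.

Lemma row_spoke_mx_norm (K : comPzRingType) (k : nat) (x : 'I_2) :
  row x (spoke_mx K k) *m (row x (spoke_mx K k))^T = (gram_mx K k x x)%:M.
Proof.
rewrite [LHS]mx11_scalar; congr (_%:M).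
by rewrite -spoke_mx_gram !mxE; apply: eq_bigr => w _; rewrite !mxE.
Qed.

(** Passing from the integers to a larger ring allows testing irrational eigenvalues. *)
Lemma cospectral_adjmx (K : comNzRingType) (X : sgraph) (u v : 'I_(gorder X)) :
  cospectral u v ->
  char_poly (adjmx K (del_vertex u)) = char_poly (adjmx K (del_vertex v)).
Proof.
have map_adj Y : map_mx intr (adjmx int Y) = adjmx K Y.
  by apply/matrixP => x y; rewrite !mxE rmorph_nat.
move=> /(congr1 (map_poly (intr : int -> K))).
by rewrite !(map_char_poly (intr : {rmorphism int -> K})) !map_adj.
Qed.

(** Deleting [hub1] leaves the eigenvalue sqrt(17k), whereas after deleting [hub0] a nonzero
    eigenvalue has square 8k. *)
Lemma hubs_not_cospectral (R : rcfType) (k : nat) :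
  (0 < k)%N -> ~ cospectral (hub0 k) (hub1 k).
Proof.
move=> k_gt0 /(cospectral_adjmx R) eq_char.
have k17_gt0 : 0 < (17 * k)%:R :> R by rewrite ltr0n; lia.
pose a : R := Num.sqrt (17 * k)%:R.
have a_neq0 : a != 0 by rewrite lt0r_neq0 // sqrtr_gt0.
have a2 : a ^+ 2 = (17 * k)%:R by rewrite sqr_sqrtr // ltW.
have : eigenvalue (adjmx R (del_vertex (hub1 k))) a.
  rewrite adjmx_del_hub1; apply: star_eigenvalue_sqrt a_neq0 a2.
  by rewrite row_spoke_mx_norm mxE.
rewrite eigenvalue_root_char -eq_char -eigenvalue_root_char adjmx_del_hub0.
move=> /(star_eigenvalue_cube (row_spoke_mx_norm _ _ _)).
rewrite exprSr => /(mulIf a_neq0); rewrite a2 mxE /= => /eqP.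
by rewrite eqr_nat; lia.
Qed.

(** * Fractional revival on the hubs *)

Lemma delta_hubs (K : comPzRingType) (k : nat) :
  delta_mx (hub0 k) (hub0 k) + delta_mx (hub1 k) (hub1 k) =
    block_mx 1%:M 0 0 0 :> 'M[K]_(2 + 19 * k).
Proof.
apply/matrixP => x y.
case: (split_ordP x) => i ->; case: (split_ordP y) => j ->;
  rewrite ?block_mxEul ?block_mxEur ?block_mxEdl ?block_mxEdr !mxE
    /hub0 /hub1 ?eq_lshift ?eq_rlshift ?eq_lrshift ?andbF ?addr0 //.
by case: i => [[|[|//]] ?]; case: j => [[|[|//]] ?];
  rewrite -!val_eqE /= ?addr0 ?add0r.
Qed.

Lemma hubs_revival (R : realType) (k : nat) :
  (0 < k)%N -> proper_fractional_revival R (hub0 k) (hub1 k).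
Proof.
move=> k_gt0.
have k5_gt0 : 0 < (5 * k)%:R :> R by rewrite ltr0n; lia.
(* The smaller root of the quadratic of [gram_mx] is r^2. *)
pose r : R := Num.sqrt (5 * k)%:R.
have r_gt0 : 0 < r by rewrite sqrtr_gt0.
have r_neq0 : r != 0 by rewrite lt0r_neq0.
pose z : R[i] := r%:C%C.
have z_neq0 : z != 0 by rewrite fmorph_eq0.
have z2 : z ^+ 2 = (5 * k)%:R.
  by rewrite -rmorphXn sqr_sqrtr ?rmorph_nat // ltW.
pose A := adjmx R[i] (twin_star k).
(* The hubs are a whole colour class, so the projection in the definition of revival is the [D] of
   the bipartite reduction. *)
pose D : 'M[R[i]]_(gorder (twin_star k)) :=
  delta_mx (hub0 k) (hub0 k) + delta_mx (hub1 k) (hub1 k).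
pose N : 'M[R[i]]_(2 + 19 * k) := block_mx (gram_mx R[i] k) 0 0 0.
have D_idem : D * D = D.
  by rewrite /D delta_hubs [LHS]mulmx_block !(mulmx0, mul0mx, addr0, mulmx1).
have A_bipartite : A * D + D * A = A.
  rewrite /A /D delta_hubs adjmx_twin_star.
  rewrite -[X in X + _]/(_ *m _) -[X in _ + X]/(_ *m _) !mulmx_block.
  rewrite !(mulmx0, mul0mx, addr0, add0r, mulmx1, mul1mx) add_block_mx.
  by rewrite !(addr0, add0r).
have A2D : A ^+ 2 * D = N.
  rewrite /A /D delta_hubs adjmx_twin_star.
  rewrite -[LHS]/(_ *m _ *m _) !mulmx_block.
  by rewrite !(mulmx0, mul0mx, addr0, add0r, mulmx1, mul1mx) spoke_mx_gram.
have N_quadratic : N * N = (5 * z ^+ 2) *: N - (4 * z ^+ 4) *: D.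
  rewrite /N /D delta_hubs [LHS]mulmx_block !(mulmx0, mul0mx, addr0, add0r).
  rewrite !scale_block_mx opp_block_mx add_block_mx !scaler0 !subr0.
  rewrite gram_mx_quadratic (exprM z 2 2) z2.
  congr (block_mx (_ *: _ - _ *: _) _ _ _).
    by rewrite -natrM; congr (_%:R); lia.
  by rewrite -natrX -natrM; congr (_%:R); lia.
have A_quintic := bipartite_block_quintic D_idem A_bipartite A2D N_quadratic.
pose U := 1 - (2 / (3 * z ^+ 4)) *: ((4 * z ^+ 2) *: A ^+ 2 - A ^+ 4).
have transitionE t : cos (t * r) = -1 -> sin (t * r) = 0 ->
    transition (twin_star k) t = U.
  exact: expmx_quintic r_neq0 A_quintic t.
have transition_p : transition (twin_star k) (pi / r) = U.
  by apply: transitionE; rewrite divfK // ?cospi ?sinpi.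
(* The walk takes the same value at opposite times, so revival is the identity U D U = D. *)
have transition_n : transition (twin_star k) (- (pi / r)) = U.
  apply: transitionE; rewrite mulNr divfK //.
    by rewrite cosN cospi.
  by rewrite sinN sinpi oppr0.
exists (pi / r); split.
- by rewrite divr_gt0 // pi_gt0.
- rewrite /fractional_revival transition_p transition_n.
  exact: (bipartite_block_conj D_idem A_bipartite A2D N_quadratic z_neq0).
(* Right multiplication by [D] fixes the column of [hub1], so the entry can be read off U D: it is 2
   / (15k) * 6k = 4/5. *)
- have D_hub1 w : D w (hub1 k) = (w == hub1 k)%:R.
    by rewrite !mxE (_ : (hub1 k == hub0 k) = false) // andbF add0r eqxx andbT.
  have -> : transition (twin_star k) (pi / r) (hub0 k) (hub1 k) =
      (U * D) (hub0 k) (hub1 k).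
    rewrite transition_p [RHS]mxE (bigD1 (hub1 k)) //= big1 ?addr0.
      by rewrite D_hub1 eqxx mulr1.
    by move=> w /negPf w_neq; rewrite D_hub1 w_neq mulr0.
  rewrite (bipartite_block_mulr D_idem A_bipartite A2D N_quadratic) //.
  have -> a b : (a *: N - b *: D) (hub0 k) (hub1 k) =
      a * N (hub0 k) (hub1 k) - b * D (hub0 k) (hub1 k) by rewrite !mxE.
  rewrite D_hub1 mulr0 subr0.
  rewrite [N _ _]block_mxEul mxE z2 /= mulf_neq0 ?mulf_neq0 ?invr_neq0 //.
  all: by rewrite -?natrM pnatr_eq0; lia.
Qed.

Theorem theorem3p6 (R : realType) :
  exists X : nat -> sgraph,
    (forall i j : nat, i <> j -> ~ isomorphic (X i) (X j)) /\
    (forall i : nat, exists u v : 'I_(gorder (X i)),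
       [/\ u <> v, ~ cospectral u v & proper_fractional_revival R u v]).
Proof.
(* The shift avoids k = 0, which has no leaves; distinct indices give distinct orders 2 + 19k. *)
exists (fun i => twin_star i.+1); split.
  by move=> i j i_neq_j /isomorphic_gorder /=; lia.
move=> i; exists (hub0 i.+1), (hub1 i.+1); split.
- by move/(congr1 val).
- exact: (hubs_not_cospectral R).
- exact: hubs_revival.
Qed.
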